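(* A linear map $\phi:\mathfrak{m}_2\to\mathfrak{m}_2$ is commuting if and only if it is a scalar multiple of $\sum_{i\geq 1}e^{i}_{i}$, i.e. if and only if there is $\lambda\in\mathbb{F}$ with $\phi(e_i)=\lambda e_i$ for all $i\geq 1$.
   Context: The ground field $\mathbb{F}$ is algebraically closed of characteristic zero. $\mathfrak{m}_2$ is the $\mathbb{N}$-graded Lie algebra over $\mathbb{F}$ with basis $\{e_i\mid i\geq 1\}$, $e_i$ homogeneous of degree $i$, whose only non-trivial brackets (up to skew-symmetry) are $[e_1,e_i]=e_{i+1}$ for all $i\geq 2$ and $[e_2,e_j]=e_{j+2}$ for all $j\geq 3$. A linear map $\phi$ of a Lie algebra $\mathfrak{g}$ to itself is called commuting if $[\phi(x),x]=0$ for every $x\in\mathfrak{g}$. The map $e_i^j$ is the linear map sending $e_i$ to $e_j$ and all other basis vectors to $0$; infinite sums are understood by evaluation on basis vectors. *)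

(* Defs.v *)
From HB Require Import structures.
From mathcomp Require Import all_boot all_algebra.
From mathcomp Require Import ring zify.

Set Implicit Arguments.
Unset Strict Implicit.
Unset Printing Implicit Defensive.

Import GRing.Theory.
Local Open Scope ring_scope.

HB.mixin Record isLieAlgebra (R : comNzRingType) (L : Type)
    of GRing.Lmodule R L := {
  lie : L -> L -> L;
  lie_bilinear : bilinear_for *:%R *:%R lie;
  liexx : forall x, lie x x = 0;
  lie_jacobi : forall x y z,
    lie x (lie y z) + lie y (lie z x) + lie z (lie x y) = 0
}.

#[short(type="lieAlgType")]
HB.structure Definition LieAlgebra (R : comNzRingType) :=
  { L of isLieAlgebra R L & GRing.Lmodule R L }.

Definition commuting (R : comNzRingType) (L : lieAlgType R)
    (phi : {linear L -> L}) : Prop :=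
  forall x : L, lie (phi x) x = 0.

(* The vector space with basis e_1, e_2, ...; a vector is stored as the
   polynomial with coefficient sequence its coordinates, so that e_i is 'X^(i-1)
   and only the vector space structure of {poly F} is retained. *)
Definition m2 (F : fieldType) : Type := {poly F}.
HB.instance Definition _ (F : fieldType) := GRing.Lmodule.on (m2 F).

Section M2.
Variable F : fieldType.

(* The degree 0 component is zero: m2_e 0 is the zero vector. *)
Definition m2_e (i : nat) : m2 F := if i is k.+1 then 'X^k : {poly F} else 0.

Definition m2_coord (i : nat) (x : m2 F) : F :=
  if i is k.+1 then (x : {poly F})`_k else 0.

(* The bound \sum_(1 <= i < m2_bound x) covers the support of x. *)
Definition m2_bound (x : m2 F) : nat := (size (x : {poly F})).+1.

Definition m2_half (i j : nat) : bool :=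
  (i == 1) && (2 <= j)%N || (i == 2) && (3 <= j)%N.

(* [e_i, e_j] = m2_sc i j *: e_(i+j) *)
Definition m2_sc (i j : nat) : F := (m2_half i j)%:R - (m2_half j i)%:R.

Definition m2_bracket (x y : m2 F) : m2 F :=
  \sum_(1 <= i < m2_bound x) \sum_(1 <= j < m2_bound y)
    (m2_coord i x * m2_coord j y * m2_sc i j) *: m2_e (i + j).

Lemma m2_coord_is_linear i : linear_for *%R (m2_coord i).
Proof. by case: i => [|i] a x y /=; rewrite ?mulr0 ?addr0 // coefD coefZ. Qed.
HB.instance Definition _ i :=
  GRing.isLinear.Build F (m2 F) F *%R (m2_coord i) (m2_coord_is_linear i).

Lemma m2_coord_e i j : m2_coord i (m2_e j) = ((0 < i)%N && (i == j))%:R.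
Proof. by case: i j => [|i] [|j] //=; rewrite ?coef0 // coefXn. Qed.

Lemma m2_coord_oversize i x : (m2_bound x <= i)%N -> m2_coord i x = 0.
Proof. by case: i => //= i; rewrite ltnS => /leq_sizeP ->. Qed.

Lemma m2_coordP (x y : m2 F) :
  (forall i, (0 < i)%N -> m2_coord i x = m2_coord i y) -> x = y.
Proof. by move=> h; apply/polyP => i; exact: (h i.+1). Qed.

Lemma big_widen0 (V : nmodType) (f : nat -> V) m n : (0 < m <= n)%N ->
  (forall i, (m <= i)%N -> f i = 0) ->
  \sum_(1 <= i < m) f i = \sum_(1 <= i < n) f i.
Proof.
move=> /andP[m0 mn] h; rewrite (big_cat_nat m0 mn) /= [X in _ + X]big1_seq ?addr0 //.
by move=> i; rewrite mem_index_iota => /and3P[_ /h].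
Qed.

Lemma m2_decomp n (x : m2 F) : (m2_bound x <= n)%N ->
  x = \sum_(1 <= i < n) m2_coord i x *: m2_e i.
Proof.
move=> h; apply: m2_coordP => i i0; rewrite linear_sum /=.
have [lt_in|le_ni] := ltnP i n.
  rewrite (bigD1_seq i) ?mem_index_iota ?i0 ?iota_uniq //= big1_seq.
    by rewrite linearZ /= m2_coord_e i0 eqxx mulr1 addr0.
  by move=> j /andP[/negPf ji _]; rewrite linearZ /= m2_coord_e eq_sym ji andbF mulr0.
rewrite m2_coord_oversize ?(leq_trans h) // big1_seq // => j.
rewrite mem_index_iota => /and3P[_ j0 jn].
by rewrite linearZ /= m2_coord_e (gtn_eqF (leq_trans jn le_ni)) andbF mulr0.
Qed.

Lemma m2_bracketEn n (x y : m2 F) : (m2_bound x <= n)%N -> (m2_bound y <= n)%N ->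
  m2_bracket x y = \sum_(1 <= i < n) \sum_(1 <= j < n)
    (m2_coord i x * m2_coord j y * m2_sc i j) *: m2_e (i + j).
Proof.
move=> hx hy; rewrite /m2_bracket (@big_widen0 _ _ _ n) //.
  apply: eq_bigr => i _; apply: big_widen0 => // j hj.
  by rewrite (m2_coord_oversize hj) mulr0 mul0r scale0r.
move=> i hi; apply: big1 => j _.
by rewrite (m2_coord_oversize hi) !mul0r scale0r.
Qed.

Lemma m2_scC i j : m2_sc i j = - m2_sc j i.
Proof. by rewrite opprB. Qed.

Lemma m2_sc0 j : m2_sc 0 j = 0.
Proof. by rewrite /m2_sc /m2_half !andbF /= subr0. Qed.

Lemma m2_bracketC x y : m2_bracket x y = - m2_bracket y x.
Proof.
pose n := maxn (m2_bound x) (m2_bound y).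
rewrite !(@m2_bracketEn n) ?leq_maxl ?leq_maxr // exchange_big -sumrN.
apply: eq_bigr => i _; rewrite -sumrN; apply: eq_bigr => j _.
by rewrite -scaleNr addnC m2_scC mulrN [m2_coord j x * _]mulrC.
Qed.

Lemma m2_bracket_linearr x : linear (m2_bracket x).
Proof.
move=> a y z.
pose n := maxn (maxn (m2_bound x) (m2_bound (a *: y + z)))
               (maxn (m2_bound y) (m2_bound z)).
rewrite !(@m2_bracketEn n) /n; do ?by rewrite !leq_max leqnn ?orbT.
rewrite scaler_sumr -big_split; apply: eq_bigr => i _ /=.
rewrite scaler_sumr -big_split; apply: eq_bigr => j _ /=.
by rewrite linearP /= scalerA -scalerDl; congr (_ *: _); ring.
Qed.

Lemma m2_bracket_bilinear : bilinear_for *:%R *:%R m2_bracket.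
Proof.
split=> [y a x z|x]; last exact: m2_bracket_linearr.
rewrite /= (m2_bracketC (_ + _)) m2_bracket_linearr opprD -scalerN.
by rewrite -!(m2_bracketC _ y).
Qed.

HB.instance Definition _ :=
  bilinear_isBilinear.Build F (m2 F) (m2 F) (m2 F) *:%R *:%R m2_bracket
    m2_bracket_bilinear.

Lemma m2_bracketxx x : m2_bracket x x = 0.
Proof.
rewrite /m2_bracket; elim: (m2_bound x) => [|n IHn]; first by rewrite big_geq.
case: n IHn => [|n] IHn; first by rewrite big_geq.
rewrite big_nat_recr //=; under eq_bigr do rewrite big_nat_recr //=.
rewrite big_split /= IHn add0r [X in _ + X]big_nat_recr //= addrA -big_split /=.
rewrite [m2_sc n.+1 n.+1]subrr mulr0 scale0r addr0 big1 // => i _.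
by rewrite addnC -scalerDl m2_scC mulrN [m2_coord i x * _]mulrC addNr scale0r.
Qed.

Lemma m2_bracket_e i j : m2_bracket (m2_e i) (m2_e j) = m2_sc i j *: m2_e (i + j).
Proof.
case: i j => [|i] [|j].
- by rewrite linear0r scaler0.
- by rewrite linear0l m2_sc0 scale0r.
- by rewrite linear0r m2_scC m2_sc0 oppr0 scale0r.
rewrite /m2_bracket /m2_bound /= !size_polyXn.
rewrite big_nat_recr //= big1_seq ?add0r; last first.
  move=> k; rewrite mem_index_iota => /and3P[_ k0 hk]; apply: big1 => l _.
  by rewrite (m2_coord_e _ i.+1) (ltn_eqF hk) andbF !mul0r scale0r.
rewrite big_nat_recr //= big1_seq ?add0r; last first.
  move=> k; rewrite mem_index_iota => /and3P[_ k0 hk].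
  by rewrite (m2_coord_e _ j.+1) (ltn_eqF hk) andbF mulr0 mul0r scale0r.
by rewrite !coefXn !eqxx !mul1r.
Qed.

Lemma m2_sc_jacobi i j k :
  m2_sc j k * m2_sc i (j + k) + m2_sc k i * m2_sc j (k + i)
  + m2_sc i j * m2_sc k (i + j) = 0.
Proof.
rewrite /m2_sc /m2_half.
by case: i => [|[|[|i]]]; case: j => [|[|[|j]]]; case: k => [|[|[|k]]];
   rewrite ?addnS ?addSn ?addn0 ?add0n /=; ring.
Qed.

Lemma m2_jacobi x y z :
  m2_bracket x (m2_bracket y z) + m2_bracket y (m2_bracket z x)
  + m2_bracket z (m2_bracket x y) = 0.
Proof.
rewrite (m2_decomp (leqnn (m2_bound x))) (m2_decomp (leqnn (m2_bound y)))
        (m2_decomp (leqnn (m2_bound z))).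
elim/big_rec: _ => [|i u _ IHx]; first by rewrite !(linear0l, linear0r, addr0).
rewrite !(linearDl, linearDr) /=.
have -> : forall a b c d p q : m2 F, a + b + (c + d) + (p + q)
    = (a + c + p) + (b + d + q).
  by move=> *; rewrite (AC (2*2*2) ((1*3*5)*(2*4*6))).
rewrite IHx addr0 {IHx}.
elim/big_rec: _ => [|j v _ IHy]; first by rewrite !(linear0l, linear0r, addr0).
rewrite !(linearDl, linearDr) /=.
have -> : forall a b c d p q : m2 F, a + b + (c + d) + (p + q)
    = (a + c + p) + (b + d + q).
  by move=> *; rewrite (AC (2*2*2) ((1*3*5)*(2*4*6))).
rewrite IHy addr0 {IHy}.
elim/big_rec: _ => [|k w _ IHz]; first by rewrite !(linear0l, linear0r, addr0).
rewrite !(linearDl, linearDr) /=.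
have -> : forall a b c d p q : m2 F, a + b + (c + d) + (p + q)
    = (a + c + p) + (b + d + q).
  by move=> *; rewrite (AC (2*2*2) ((1*3*5)*(2*4*6))).
rewrite IHz addr0 {IHz}.
rewrite !(linearZl_LR, linearZr_LR) /= !m2_bracket_e !linearZr_LR /= !m2_bracket_e.
have -> : (j + (k + i))%N = (i + (j + k))%N by lia.
have -> : (k + (i + j))%N = (i + (j + k))%N by lia.
rewrite !scalerA -!scalerDl.
rewrite (_ : _ + _ + _ = m2_coord i x * m2_coord j y * m2_coord k z *
  (m2_sc j k * m2_sc i (j + k) + m2_sc k i * m2_sc j (k + i)
   + m2_sc i j * m2_sc k (i + j))); first by rewrite m2_sc_jacobi mulr0 scale0r.
ring.
Qed.

HB.instance Definition _ := isLieAlgebra.Build F (m2 F)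
  m2_bracket_bilinear m2_bracketxx m2_jacobi.

(* The map e_i^j: e_i |-> e_j, other basis vectors |-> 0. *)
Definition m2_elem (i j : nat) (x : m2 F) : m2 F := m2_coord i x *: m2_e j.

Lemma m2_elem_is_linear i j : linear (m2_elem i j).
Proof. by move=> a x y; rewrite /m2_elem linearP scalerDl scalerA. Qed.
HB.instance Definition _ i j :=
  GRing.isLinear.Build F (m2 F) (m2 F) *:%R (m2_elem i j) (m2_elem_is_linear i j).

(* phi = \sum_(i >= 1) f i, evaluated on basis vectors: for each k >= 1 only
   finitely many f i (e_k) matter and they add up to phi (e_k). *)
Definition m2_is_sum (f : nat -> {linear m2 F -> m2 F})
    (phi : {linear m2 F -> m2 F}) : Prop :=
  forall k, (0 < k)%N -> exists N, forall n, (N <= n)%N ->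
    phi (m2_e k) = \sum_(1 <= i < n.+1) f i (m2_e k).

Lemma m2_lie_e1 i : (2 <= i)%N -> lie (m2_e 1) (m2_e i) = m2_e i.+1.
Proof.
by case: i => [|[|i]] // _; rewrite [lie _ _]m2_bracket_e /m2_sc /m2_half /= ?andbF subr0 scale1r.
Qed.

Lemma m2_lie_e2 j : (3 <= j)%N -> lie (m2_e 2) (m2_e j) = m2_e j.+2.
Proof.
by case: j => [|[|[|j]]] // _; rewrite [lie _ _]m2_bracket_e /m2_sc /m2_half /= ?andbF subr0 scale1r.
Qed.

Lemma m2_lie_ee i j : (3 <= i)%N -> (3 <= j)%N -> lie (m2_e i) (m2_e j) = 0.
Proof.
case: i j => [|[|[|i]]] [|[|[|j]]] // _ _.
by rewrite [lie _ _]m2_bracket_e /m2_sc /m2_half /= ?andbF subr0 scale0r.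
Qed.

Lemma m2_elem_e i j k : (0 < i)%N ->
  m2_elem i j (m2_e k) = if k == i then m2_e j else 0.
Proof.
by move=> i0; rewrite /m2_elem m2_coord_e i0 eq_sym; case: eqP; rewrite ?scale1r ?scale0r.
Qed.

End M2.

(* Main.v *)
Require Import Defs.
From HB Require Import structures.
From mathcomp Require Import all_boot all_algebra.

Set Implicit Arguments.
Unset Strict Implicit.
Unset Printing Implicit Defensive.

Import GRing.Theory.
Local Open Scope ring_scope.

(** The centralizer of e_1 is the line spanned by e_1, so a commuting phi has
    phi e_1 = lambda e_1. Polarization gives [phi x, y] = [x, phi y], whence
    [e_1, phi y] = lambda [e_1, y] and phi y - lambda y = c e_1 for every y.
    For y = e_i with i >= 2, 0 = [phi y, y] = c e_(i+1), so c = 0. *)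

(** Lets the generic lemmas on bilinear maps rewrite under [lie] in any Lie algebra. *)
HB.instance Definition _ (R : comNzRingType) (L : lieAlgType R) :=
  bilinear_isBilinear.Build R L L L *:%R *:%R (@lie R L) (@lie_bilinear R L).

Lemma lieDl (R : comNzRingType) (L : lieAlgType R) (x y z : L) :
  lie (x + y) z = lie x z + lie y z.
Proof. exact: linearDl. Qed.

Lemma lieZl (R : comNzRingType) (L : lieAlgType R) (a : R) (x y : L) :
  lie (a *: x) y = a *: lie x y.
Proof. exact: linearZl_LR. Qed.

Lemma lieC (R : comNzRingType) (L : lieAlgType R) (x y : L) :
  lie x y = - lie y x.
Proof.
apply/eqP; rewrite -addr_eq0; have := liexx (x + y).
by rewrite lieDl !linearDr /= !liexx add0r addr0 addrC => /eqP; rewrite addrC.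
Qed.

(** Expanding [phi (x + y), x + y] = 0 leaves [phi x, y] + [phi y, x] = 0; skew-symmetry turns the
    second term around. *)
Lemma commuting_lie (R : comNzRingType) (L : lieAlgType R)
    (phi : {linear L -> L}) (x y : L) :
  commuting phi -> lie (phi x) y = lie x (phi y).
Proof.
move=> phiC; have := phiC (x + y).
rewrite linearD lieDl !linearDr /= !phiC add0r addr0 => /eqP.
by rewrite addr_eq0 -lieC => /eqP.
Qed.

Lemma commuting_scale (R : comNzRingType) (L : lieAlgType R)
    (phi : {linear L -> L}) (lambda : R) :
  (forall x, phi x = lambda *: x) -> commuting phi.
Proof. by move=> phiE x; rewrite phiE lieZl liexx scaler0. Qed.

Section M2Commuting.
Variable F : fieldType.
Implicit Types (phi : {linear m2 F -> m2 F}) (x : m2 F).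

Lemma m2_linear_ext (f g : {linear m2 F -> m2 F}) :
  (forall i, (0 < i)%N -> f (m2_e F i) = g (m2_e F i)) -> f =1 g.
Proof.
move=> fg x; rewrite (m2_decomp (leqnn (m2_bound x))) !linear_sum /=.
apply: eq_big_seq => i; rewrite mem_index_iota => /andP[i0 _].
by rewrite !linearZ /= fg.
Qed.

Lemma m2_coordZ i (a : F) x : m2_coord i (a *: x) = a * m2_coord i x.
Proof. exact: linearZ. Qed.

(** By linearity it suffices to take x = e_j. For j >= 2 the bracket with e_1 shifts the index by
    one; for j = 1 both sides vanish, the right one because i >= 2. *)
Lemma m2_coord_lie_e1 i x : (2 <= i)%N ->
  m2_coord i.+1 (lie (m2_e F 1) x) = m2_coord i x.
Proof.
move=> i2; rewrite [in LHS](m2_decomp (leqnn (m2_bound x))).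
rewrite [in RHS](m2_decomp (leqnn (m2_bound x))) linear_sumr !linear_sum.
apply: eq_big_seq => j; rewrite mem_index_iota => /andP[j0 _].
rewrite linearZr_LR !linearZ; congr (_ * _).
(* Restates both sides, up to conversion, through [m2_coord] and [lie]. *)
rewrite -[LHS]/(m2_coord i.+1 (lie _ _)) -[RHS]/(m2_coord i _).
case: j j0 => [|[|j]] // _; last first.
  by rewrite m2_lie_e1 // !m2_coord_e eqSS (ltnW i2).
by rewrite liexx linear0 m2_coord_e gtn_eqF ?andbF.
Qed.

(** For i >= 2 the coordinate of x at e_i reappears in [e_1, x] at e_(i+1), so it is zero. *)
Lemma m2_centralizer_e1 x :
  lie (m2_e F 1) x = 0 -> x = m2_coord 1 x *: m2_e F 1.
Proof.
move=> e1x; apply: m2_coordP => -[|[|i]] // _; rewrite m2_coordZ m2_coord_e.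
  by rewrite mulr1.
by rewrite mulr0 -m2_coord_lie_e1 // e1x linear0.
Qed.

Lemma m2_e_neq0 i : (0 < i)%N -> m2_e F i != 0.
Proof. by case: i => // i _; rewrite -size_poly_eq0 size_polyXn. Qed.

Lemma m2_commutingP phi :
  commuting phi <-> exists lambda : F, forall x, phi x = lambda *: x.
Proof.
split=> [phiC | [lambda]]; last exact: commuting_scale.
have phi_e1 : phi (m2_e F 1) = m2_coord 1 (phi (m2_e F 1)) *: m2_e F 1.
  by apply: m2_centralizer_e1; rewrite -commuting_lie.
exists (m2_coord 1 (phi (m2_e F 1))); move: (m2_coord _ _) phi_e1 => l phi_e1.
(* The case of e_1 is [phi_e1]; only e_(i+2) remains. *)
apply: (@m2_linear_ext phi (l \*: idfun)%R) => -[|[|i]] // _ /=.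
have /m2_centralizer_e1 : lie (m2_e F 1) (phi (m2_e F i.+2) - l *: m2_e F i.+2) = 0.
  by rewrite linearBr /= -commuting_lie // phi_e1 linearZl_LR linearZr_LR subrr.
move: (m2_coord _ _) => c /eqP; rewrite subr_eq => /eqP phi_ei.
have := phiC (m2_e F i.+2).
(* With phi e_(i+2) = c e_1 + l e_(i+2), the bracket with e_(i+2) reduces to c e_(i+3). *)
rewrite phi_ei lieDl !lieZl liexx scaler0 addr0 m2_lie_e1 //.
move=> /eqP; rewrite scaler_eq0 (negPf (m2_e_neq0 _)) // orbF => /eqP ->.
by rewrite scale0r add0r.
Qed.

Lemma m2_sum_elem_e n k : (0 < k <= n)%N ->
  \sum_(1 <= i < n.+1) m2_elem i i (m2_e F k) = m2_e F k.
Proof.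
move=> /andP[k0 kn].
rewrite (bigD1_seq k) ?mem_index_iota ?k0 ?iota_uniq //= m2_elem_e // eqxx.
rewrite big_seq_cond big1 ?addr0 // => i.
rewrite mem_index_iota => /andP[/andP[i0 _] ik].
by rewrite m2_elem_e // eq_sym (negPf ik).
Qed.

(** On e_k the partial sums are constant, equal to e_k, from n = k on, so the formal infinite sum is
    the identity. *)
Lemma m2_is_sum_elemP phi : m2_is_sum (fun i => m2_elem i i) phi <-> phi =1 id.
Proof.
split=> [phi_sum | phi1 k k0].
  apply: (@m2_linear_ext phi idfun) => k k0 /=.
  (* Evaluate at [maxn N k], past both the stabilization bound and the index k. *)
  have [N /(_ _ (leq_maxl N k)) ->] := phi_sum k k0.
  by rewrite m2_sum_elem_e // k0 leq_maxr.
by exists k => n kn; rewrite m2_sum_elem_e ?k0 // phi1.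
Qed.

End M2Commuting.

Theorem theorem4p2 (F : closedFieldType) (char0 : [pchar F] =i pred0)
    (phi : {linear m2 F -> m2 F}) :
  (commuting phi <->
     exists (lambda : F) (S : {linear m2 F -> m2 F}),
       m2_is_sum (fun i => m2_elem i i) S /\ forall x, phi x = lambda *: S x) /\
  (commuting phi <->
     exists lambda : F, forall i, (0 < i)%N -> phi (m2_e F i) = lambda *: m2_e F i).
Proof.
split; split.
- move=> /m2_commutingP[l phiE]; exists l, idfun; split=> //.
  exact/m2_is_sum_elemP.
- move=> [l [S [/m2_is_sum_elemP S1 phiE]]]; apply/m2_commutingP.
  by exists l => x; rewrite phiE S1.
- by move=> /m2_commutingP[l phiE]; exists l => i _.
- move=> [l phiE]; apply/m2_commutingP; exists l.
  exact: (@m2_linear_ext F phi (l \*: idfun)%R).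
Qed.
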